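(* Let $m\ge 2$ and $n\ge 2$ be integers. The number of spanning trees of $\mathrm{EC}_{m,n}$ is $P(\mathrm{OC}_{m-2,n-2};4)$, and the number of spanning trees of $\mathrm{OC}_{m,n}$ is $P(\mathrm{EC}_{m-2,n-2};4)$.
   Context: For a graph $\Gamma$, $P(\Gamma;x)$ denotes the (monic) characteristic polynomial $\det(xI-A)$ of its adjacency matrix $A$, and $P(\Gamma;4)$ is its value at $x=4$; for the graph with no vertices the characteristic polynomial equals $1$. For integers $m,n\ge 0$, consider the graph on the vertex set $\{(x,y)\in\mathbb{Z}^2 : 1\le x\le m,\ 1\le y\le n\}$ (empty if $m=0$ or $n=0$) in which $(x,y)$ is adjacent to $(x',y')$ if and only if $|x-x'|=|y-y'|=1$. $\mathrm{EC}_{m,n}$ is its induced subgraph on the vertices with $x+y$ even, and $\mathrm{OC}_{m,n}$ is its induced subgraph on the vertices with $x+y$ odd. *)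

(* Defs.v *)
From mathcomp Require Import all_boot all_order all_algebra.

Set Implicit Arguments.
Unset Strict Implicit.
Unset Printing Implicit Defensive.

Local Open Scope nat_scope.

Record sgraph := SGraph {
  vertex :> finType;
  adj : rel vertex;
  adj_sym : symmetric adj;
  adj_irr : irreflexive adj }.

Section Induced.
Variables (G : sgraph) (P : pred G).

Definition induced_adj : rel {x : G | P x} := [rel u v | adj (val u) (val v)].

Fact induced_adj_sym : symmetric induced_adj.
Proof. by move=> u v; rewrite /induced_adj /= adj_sym. Qed.

Fact induced_adj_irr : irreflexive induced_adj.
Proof. by move=> u; rewrite /induced_adj /= adj_irr. Qed.

Definition induced : sgraph := SGraph induced_adj_sym induced_adj_irr.

End Induced.

Definition adjacency_mx (G : sgraph) : 'M[int]_#|G| :=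
  (\matrix_(i, j) (adj (enum_val i) (enum_val j))%:R)%R.

Definition graph_char_poly (G : sgraph) : {poly int} :=
  char_poly (adjacency_mx G).

Definition edges (G : sgraph) : {set {set G}} :=
  [set e | [exists x : G, exists y : G, adj x y && (e == [set x; y])]].

(* The relation of the graph whose vertices are all of T and whose edges are
   the two-element sets in F. *)
Definition edge_rel (T : finType) (F : {set {set T}}) : rel T :=
  [rel x y | [set x; y] \in F].

Definition connected (T : finType) (e : rel T) : bool :=
  [forall x, forall y, connect e x y].

(* No simple cycle of length at least 3. The length is bounded by #|T| only to
   get a boolean; acyclicP gives the unbounded form. *)
Definition acyclic (T : finType) (e : rel T) : bool :=
  [forall k : 'I_#|T|.+1, forall c : k.-tuple T,
     (2 < k) ==> ~~ (uniq c && cycle e c)].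

Lemma acyclicP (T : finType) (e : rel T) :
  reflect (forall c : seq T, 2 < size c -> uniq c -> ~~ cycle e c)
          (acyclic e).
Proof.
apply: (iffP forallP) => [acy c c_gt2 Uc | acy k].
  have lt_c : size c < #|T|.+1 by rewrite ltnS -(card_uniqP Uc) max_card.
  have /forallP/(_ (in_tuple c)) := acy (Ordinal lt_c).
  by rewrite /= c_gt2 Uc.
apply/forallP=> c; apply/implyP=> k_gt2; apply/negP=> /andP[Uc].
by apply/negP/acy; rewrite ?size_tuple.
Qed.

(* A spanning tree is identified with its edge set. *)
Definition spanning_trees (G : sgraph) : {set {set {set G}}} :=
  [set F : {set {set G}} |
    [&& F \subset edges G, connected (edge_rel F) & acyclic (edge_rel F)]].

(* (i, j) : 'I_m * 'I_n stands for the lattice point (i + 1, j + 1). *)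
Definition xcoord m n (p : 'I_m * 'I_n) : nat := p.1.+1.
Definition ycoord m n (p : 'I_m * 'I_n) : nat := p.2.+1.

Section DiagonalGrid.
Variables m n : nat.

Definition diag_adj : rel ('I_m * 'I_n) :=
  [rel p q | (`|xcoord p - xcoord q|%N == 1) && (`|ycoord p - ycoord q|%N == 1)].

Fact diag_adj_sym : symmetric diag_adj.
Proof. by move=> p q; rewrite /diag_adj /= distnC [X in _ && (X == _)]distnC. Qed.

Fact diag_adj_irr : irreflexive diag_adj.
Proof. by move=> p; rewrite /diag_adj /= distnn. Qed.

Definition diag_grid : sgraph := SGraph diag_adj_sym diag_adj_irr.

Definition EC : sgraph :=
  @induced diag_grid [pred p | ~~ odd (xcoord p + ycoord p)].

Definition OC : sgraph :=
  @induced diag_grid [pred p | odd (xcoord p + ycoord p)].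

End DiagonalGrid.

(* Main.v *)
Require Import Defs.
From mathcomp Require Import all_boot all_order all_algebra.
From mathcomp Require Import perm ring lra zify.

(** Let G be one of the two checkerboard graphs on the m x n grid.  Each unit
    cell of the grid has exactly one diagonal that joins two vertices of G, so
    the edges of G are indexed by the cells.  G is a plane graph; its bounded
    faces are the squares around the interior grid points of the other parity.
    These points form the other checkerboard graph H on the (m - 2) x (n - 2)
    grid, and two faces share an edge exactly when the two points are adjacent
    in H.  Orienting the edges suitably, the face boundaries are signed edge
    vectors [face_cycle], and since each face has four sides, their Gram
    matrix is 4 - A(H) ([face_cycle_gram]), whose determinant is P(H; 4).

    It remains to see that this determinant counts the spanning trees of G.
    This holds for any basis C of the lattice of integer flows of a connected
    graph ([card_trees_det]), as in the matrix-tree theorem: by Cauchy-Binet,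
    det (C C^T) is the sum of the squares of the maximal minors of C, and the
    minor with column set S is 1 or -1 when the complement of S is a spanning
    tree, and 0 otherwise ([det_minor_sqr]).  If the complement of S is
    disconnected, a cut that avoids it is orthogonal to all flows, which gives
    a kernel vector of the minor.  If it contains a cycle, the flow around that
    cycle is a combination of the rows of C that vanishes on S.  If it is a
    spanning tree, the fundamental cycles of the edges in S, written in the
    basis C, form the inverse of the minor; this inverse also shows that the
    complements of spanning trees have the size of the basis ([card_cotree]).

    Finally, the face boundaries are a basis of the flow lattice of G
    ([face_cycle_span], [face_cycle_free]).  The coefficients of a given flow
    are the values of a height function on the points of the other parity,
    obtained by summing the flow along one diagonal direction ([height]);
    conservation at the vertices of G makes the height differences along the
    other direction equal to the flow as well ([height_diff]), and the height
    vanishes on and beyond the far sides of the grid because the flow vanishes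
    beyond them ([height_right], [height_top]). *)

Set Implicit Arguments.
Unset Strict Implicit.
Unset Printing Implicit Defensive.
Import Order.TTheory GRing.Theory Num.Theory.
Local Open Scope ring_scope.

(** * Gram determinants *)

(** The Cauchy-Binet formula for C C^T, summed over all maps g that select
    columns rather than over k-subsets: each subset is then counted k! times,
    and no ordering of the columns has to be chosen. *)
Lemma fact_det_gram (R : comNzRingType) (E : finType) (k : nat)
    (C : 'I_k -> E -> R) :
  k`!%:R * \det (\matrix_(i, j) \sum_e C i e * C j e) =
  \sum_(g : {ffun 'I_k -> E}) \det (\matrix_(i, j) C i (g j)) ^+ 2.
Proof.
have expand : \det (\matrix_(i, j) \sum_e C i e * C j e) =
    \sum_(g : {ffun 'I_k -> E})
      (\prod_i C i (g i)) * \det (\matrix_(i, j) C i (g j)).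
  rewrite /determinant; under eq_bigr do
    [under eq_bigr do rewrite mxE; rewrite bigA_distr_bigA mulr_sumr].
  rewrite exchange_big; apply: eq_bigr => g _ /=.
  rewrite -[RHS]/(_ * \det _) -det_tr mulr_sumr; apply: eq_bigr => s _.
  rewrite big_split /= mulrCA; congr (_ * (_ * _)).
  by apply: eq_bigr => i _; rewrite !mxE.
(* Summing the expansion over the relabellings g o s of each g turns the product
   of the C i (g i) into a second copy of the determinant. *)
have permuted (s : 'S_k) : \det (\matrix_(i, j) \sum_e C i e * C j e) =
    \sum_(g : {ffun 'I_k -> E})
      (-1) ^+ s * (\prod_i C i (g (s i))) * \det (\matrix_(i, j) C i (g j)).
  pose act (t : 'S_k) (g : {ffun 'I_k -> E}) := [ffun i => g (t i)].
  have actK : cancel (act s) (act s^-1%g).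
    by move=> g; apply/ffunP=> i; rewrite !ffunE permKV.
  have actVK : cancel (act s^-1%g) (act s).
    by move=> g; apply/ffunP=> i; rewrite !ffunE permK.
  rewrite expand (reindex (act s)); last by exists (act s^-1%g) => g _.
  apply: eq_bigr => g _ /=.
  have -> : \matrix_(i, j) C i (act s g j) =
            (\matrix_(i, j) C i (g j)) *m (perm_mx s)^T.
    by rewrite tr_perm_mx -col_permE; apply/matrixP=> i j; rewrite !mxE ffunE.
  rewrite det_mulmx det_tr det_perm mulrA mulrC mulrA; congr (_ * _ * _).
  by apply: eq_bigr => i _; rewrite ffunE.
rewrite mulr_natl -{1}(card_Sn k) -sumr_const.
under eq_bigl do rewrite inE.
rewrite (eq_bigr _ (fun s _ => permuted s)) exchange_big; apply: eq_bigr => g _.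
rewrite -mulr_suml expr2; congr (_ * _).
by apply: eq_bigr => s _; congr (_ * _); apply: eq_bigr => i _; rewrite !mxE.
Qed.

(** * Flows on graphs with indexed oriented edges *)

Lemma eq_set2 (T : finType) (a b x y : T) :
  [set x; y] = [set a; b] -> x = a /\ y = b \/ x = b /\ y = a.
Proof.
move=> eq_xy.
have [/set2P xP /set2P yP] : x \in [set a; b] /\ y \in [set a; b].
  by rewrite -eq_xy set21 set22.
have [/set2P aP /set2P bP] : a \in [set x; y] /\ b \in [set x; y].
  by rewrite eq_xy set21 set22.
by case: xP => eq_x; case: yP => eq_y; subst; intuition.
Qed.

Section EdgeIndexedGraph.

Variables (T E : finType) (src tgt : E -> T).
Implicit Types (A : {set E}) (e : E) (x y : T) (z : E -> int).

Definition ends (e : E) : {set T} := [set src e; tgt e].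

(** [link A] is written with [edge_rel] so that the edge set of a spanning
    tree is literally of the form [ends @: A]. *)
Definition link (A : {set E}) : rel T := edge_rel (ends @: A).

Lemma linkP A x y :
  reflect
    (exists2 e, e \in A & x = src e /\ y = tgt e \/ x = tgt e /\ y = src e)
    (link A x y).
Proof.
apply: (iffP imsetP) => -[e eA]; first by move/eq_set2; exists e.
by move=> xy; exists e => //; case: xy => -[-> ->]; rewrite /ends // setUC.
Qed.

Lemma link_sym A : symmetric (link A).
Proof. by move=> x y; rewrite /link /edge_rel /= setUC. Qed.

Lemma connect_link_sym A : connect_sym (link A).
Proof. exact/sym_connect_sym/link_sym. Qed.

Lemma link_ends A e : e \in A -> link A (src e) (tgt e).
Proof. by move=> eA; apply/linkP; exists e => //; left. Qed.

Definition boundary (z : E -> int) (x : T) : int :=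
  \sum_e z e * ((tgt e == x)%:R - (src e == x)%:R).

Definition flow (z : E -> int) : Prop := forall x, boundary z x = 0.

(** Summation by parts; taking for h the indicator of a vertex set U, it says
    that the net flow across the cut of U is the total boundary inside U. *)
Lemma sum_boundary (h : T -> int) z :
  \sum_x h x * boundary z x = \sum_e z e * (h (tgt e) - h (src e)).
Proof.
have pick y : \sum_x h x * (y == x)%:R = h y.
  rewrite (bigD1 y) //= eqxx mulr1 big1 ?addr0 // => x /negPf nxy.
  by rewrite eq_sym nxy mulr0.
under eq_bigr do rewrite mulr_sumr.
rewrite exchange_big; apply: eq_bigr => e _ /=.
rewrite -!pick -sumrB mulr_sumr; apply: eq_bigr => x _; ring.
Qed.

Lemma boundaryD z1 z2 x :
  boundary (fun e => z1 e + z2 e) x = boundary z1 x + boundary z2 x.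
Proof. by rewrite -big_split; apply: eq_bigr => e _; rewrite mulrDl. Qed.

Lemma boundaryZ a z x :
  boundary (fun e => a * z e) x = a * boundary z x.
Proof. by rewrite mulr_sumr; apply: eq_bigr => e _; rewrite mulrA. Qed.

Lemma boundary_sum (I : finType) (w : I -> int) (Z : I -> E -> int) x :
  boundary (fun e => \sum_i w i * Z i e) x = \sum_i w i * boundary (Z i) x.
Proof.
under [RHS]eq_bigr do rewrite mulr_sumr.
rewrite exchange_big; apply: eq_bigr => e _ /=.
by rewrite mulr_suml; apply: eq_bigr => i _; rewrite mulrA.
Qed.

Lemma boundary_edge e x :
  boundary (fun e' => (e' == e)%:R) x = (tgt e == x)%:R - (src e == x)%:R.
Proof.
rewrite /boundary (bigD1 e) //= eqxx mul1r big1 ?addr0 // => e' /negPf->.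
by rewrite mul0r.
Qed.

(** Send one unit along the walk, edge by edge. *)
Lemma walk_flow A x y : connect (link A) x y ->
  exists2 z : E -> int, (forall e, e \notin A -> z e = 0) &
    forall v, boundary z v = (y == v)%:R - (x == v)%:R.
Proof.
case/connectP=> p; elim: p x => [|u p IHp] x /=.
  move=> _ ->; exists (fun _ => 0) => // v.
  by rewrite subrr /boundary big1 // => e _; rewrite mul0r.
case/andP=> /linkP[e eA xu] /IHp/[apply] -[z zA dz].
pose a : int := if x == src e then 1 else -1.
exists (fun e' => a * (e' == e)%:R + z e') => [e' e'A | v].
  by rewrite zA // (negPf (memPnC e'A e eA)) mulr0 addr0.
rewrite boundaryD boundaryZ boundary_edge dz {}/a.
case: xu => -[-> ->]; first by rewrite eqxx; ring.
by case: (tgt e =P src e) => [->|_]; ring.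
Qed.

(** Otherwise the component of [src e] in A without e would be a vertex set
    whose cut is crossed by the nonzero flow on e alone. *)
Lemma support_bridge A z e : flow z -> (forall e, e \notin A -> z e = 0) ->
  z e != 0 -> connect (link (A :\ e)) (src e) (tgt e).
Proof.
move=> dz zA ze; pose h x : int := (connect (link (A :\ e)) (src e) x)%:R.
have: \sum_x h x * boundary z x = 0 by rewrite big1 // => x _; rewrite dz mulr0.
rewrite sum_boundary (bigD1 e) //= big1 ?addr0 => [|e' ne'e].
  move/eqP; rewrite mulf_eq0 (negPf ze) /h connect0 /=.
  by case: (connect _ _ (tgt e)).
have [e'A|/zA->] := boolP (e' \in A); last by rewrite mul0r.
have eA' : e' \in A :\ e by rewrite !inE ne'e.
rewrite /h -(same_connect_r (@connect_link_sym _) (connect1 (link_ends eA'))).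
by rewrite subrr mulr0.
Qed.

(** Acyclicity is used in the form that every edge is a bridge.  A simple path
    joining the ends of e and avoiding e closes up with e to a simple cycle, of
    length at least 3 because no other edge has the ends of e.  Conversely the
    edge e that closes a simple cycle is bypassed by the rest of the cycle. *)
Lemma acyclic_bridges A : injective ends -> (forall e, src e != tgt e) ->
  reflect (forall e, e \in A -> ~~ connect (link (A :\ e)) (src e) (tgt e))
          (acyclic (link A)).
Proof.
move=> inj_ends loopless.
have sub e : subrel (link (A :\ e)) (link A).
  by move=> x y /linkP[e' /setD1P[_ e'A] xy]; apply/linkP; exists e'.
apply: (iffP (acyclicP _)) => [acy e eA | bridge [|x p] // p_gt2 Up].
  apply/negP=> /connectP[p0 p0_path].
  case/shortenP: p0_path => p p_path Up _ def_tgt.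
  suff p_gt1 : (1 < size p)%N.
    have /negP[] := acy (src e :: p) p_gt1 Up.
    rewrite /cycle rcons_path (sub_path (@sub e) p_path) /=.
    by rewrite -def_tgt link_sym link_ends.
  case: p => [|u [|v p]] //= in p_path {Up} def_tgt *.
    by have := loopless e; rewrite def_tgt eqxx.
  case/andP: p_path => /linkP[e' /setD1P[/eqP ne'e _]]; rewrite -def_tgt.
  move=> ends_e _; case: ne'e; apply: inj_ends; rewrite /ends.
  by case: ends_e => -[-> ->]; rewrite // setUC.
rewrite /cycle rcons_path; apply/negP=> /andP[p_path /linkP[e eA last_x]].
case: p => [|y p] // in p_gt2 Up p_path last_x *.
have neq_y : y != last y p.
  case: p => [|u p] //= in p_gt2 Up {p_path last_x} *.
  by apply: contraTneq Up => ->; rewrite mem_last !andbF.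
have := bridge e eA; apply/negP; rewrite negbK.
have step u v : ~~ (ends e \subset [set u; v]) -> link A u v ->
    link (A :\ e) u v.
  move=> nuv /linkP[e' e'A uv]; apply/linkP; exists e' => //.
  rewrite !inE e'A andbT; apply: contraNneq nuv => <-.
  by case: uv => -[-> ->]; rewrite // setUC.
have ends_e : ends e = [set x; last y p].
  by case: last_x => -[/= -> ->]; rewrite /ends // setUC.
have: connect (link (A :\ e)) x (last y p).
  apply/connectP; exists (y :: p) => //=.
  (* By simplicity, only the first step touches x, and it ends at y, which is
     not the last vertex; so no step uses e. *)
  move: p_path Up => /= /andP[xy p_path] /andP[x_yp Uyp].
  rewrite step //=; last first.
    rewrite ends_e; apply/subsetPn; exists (last y p).
      by rewrite !inE eqxx orbT.
    rewrite !inE negb_or [_ == y]eq_sym neq_y andbT.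
    by apply: contraNneq x_yp => <-; apply: mem_last.
  apply: (sub_in_path (P := predC1 x)) p_path; last first.
    by apply/allP=> u u_yp /=; apply: contraNneq x_yp => <-.
  move=> u v; rewrite !inE => nux nvx; apply: step; rewrite ends_e.
  apply/subsetPn; exists x; first by rewrite !inE eqxx.
  by rewrite !inE negb_or ![x == _]eq_sym nux.
by case: last_x => -[/= -> ->] //; rewrite connect_link_sym.
Qed.

End EdgeIndexedGraph.

(** * Spanning trees from a basis of the flow lattice *)

Lemma det_eq0_kernel n (M : 'M[int]_n) (v : 'I_n -> int) i0 :
  v i0 != 0 -> (forall i, \sum_j M i j * v j = 0) -> \det M = 0.
Proof.
move=> v0 Mv.
have Mv0 : M *m (\col_j v j) = 0.
  by apply/matrixP=> i j; rewrite !mxE -[RHS](Mv i); apply: eq_bigr => j' _;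
     rewrite mxE.
have := congr1 (mulmx (\adj M)) Mv0; rewrite mulmxA mul_adj_mx mulmx0.
move/matrixP/(_ i0 0); rewrite mul_scalar_mx !mxE => /eqP.
by rewrite mulf_eq0 (negPf v0) orbF => /eqP.
Qed.

Lemma card_inj_ffuns_onto (E : finType) k (S : {set E}) : #|S| = k ->
  #|[set g : {ffun 'I_k -> E} |
     injectiveb g & [set g i | i : 'I_k] == S]| = k`!.
Proof.
move=> cardS; have := card_inj_ffuns_on 'I_k (mem S).
rewrite cardS card_ord ffactnn => <-; apply: eq_card => g; rewrite !inE andbC.
apply: andb_id2r => /injectiveP inj_g; rewrite eqEcard card_imset // card_ord.
rewrite cardS leqnn andbT.
apply/subsetP/ffun_onP => [sub i | gS e /imsetP[i _ ->] //].
by apply: sub; apply: imset_f.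
Qed.

Section BasisDeterminant.

Variables (G : sgraph) (E : finType) (src tgt : E -> G).
Hypothesis inj_ends : injective (ends src tgt).
Hypothesis loopless : forall e, src e != tgt e.

Let conn A := connected (link src tgt A).
Let forest A := acyclic (link src tgt A).
Let tree A := conn A && forest A.

Variables (k : nat) (C : 'I_k -> E -> int).
Hypothesis C_flow : forall i, flow src tgt (C i).
Hypothesis C_span : forall z, flow src tgt z ->
  exists w : 'I_k -> int, forall e, z e = \sum_i w i * C i e.
Hypothesis C_free : forall w : 'I_k -> int,
  (forall e, \sum_i w i * C i e = 0) -> forall i, w i = 0.

Let minor l (g : 'I_l -> E) : 'M[int]_(k, l) := \matrix_(i, j) C i (g j).

(** An edge carrying flow is not a bridge of the support ([support_bridge]). *)
Lemma forest_flow0 A z : forest A -> flow src tgt z ->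
  (forall e, e \notin A -> z e = 0) -> forall e, z e = 0.
Proof.
move/(acyclic_bridges A inj_ends loopless)=> bridge dz zA e.
have [/bridge|/zA//] := boolP (e \in A); apply: contraNeq.
exact: support_bridge.
Qed.

(** Some edge e is not a bridge; one unit sent from [src e] to [tgt e] around e
    and returned through e is a flow, with value -1 on e. *)
Lemma cycle_supports_flow A : ~~ forest A ->
  exists z e,
    [/\ flow src tgt z, z e != 0 & forall e', e' \notin A -> z e' = 0].
Proof.
move=> notF.
have [e /andP[eA con]] :
    exists e, (e \in A) && connect (link src tgt (A :\ e)) (src e) (tgt e).
  apply/existsP; apply: contraR notF; rewrite negb_exists => /forallP br.
  apply/(acyclic_bridges A inj_ends loopless) => e eA.
  by have := br e; rewrite eA.
have [z zA dz] := walk_flow con.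
exists (fun e' => z e' + -1 * (e' == e)%:R), e; split.
- by move=> x; rewrite boundaryD dz boundaryZ boundary_edge; ring.
- by rewrite eqxx zA ?inE ?eqxx.
move=> e' e'A; rewrite (negPf (memPnC e'A e eA)) zA ?mulr0 //.
by rewrite !inE negb_and e'A orbT.
Qed.

(** The fundamental cycle of e: the edge e is closed up by a walk in A from its
    target to its source. *)
Lemma cotree_flow A e : conn A -> e \notin A ->
  exists2 z, flow src tgt z & forall e', e' \notin A -> z e' = (e' == e)%:R.
Proof.
move=> /forallP/(_ (tgt e))/forallP/(_ (src e)) /walk_flow[z zA dz] eA.
exists (fun e' => z e' + (e' == e)%:R).
  by move=> x; rewrite boundaryD dz boundary_edge; ring.
by move=> e' /zA ->; rewrite add0r.
Qed.

(** The rows of W are the coordinates of the fundamental cycles in the basis C.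
    Restricting a flow to the complement of the tree and summing fundamental
    cycles gives the flow back, because a forest carries no other flow than 0;
    so W is also a right inverse, and this forces l = k. *)
Lemma tree_minor_inv A l (g : 'I_l -> E) : injective g -> tree A ->
    [set g i | i : 'I_l] = ~: A ->
  exists2 W : 'M_(l, k), W *m minor g = 1%:M & minor g *m W = 1%:M.
Proof.
move=> inj_g /andP[connA forestA] im_g.
have gA j : g j \notin A by rewrite -in_setC -im_g imset_f.
have w_ex j : exists w : 'I_k -> int,
    forall e, e \notin A -> \sum_i w i * C i e = (e == g j)%:R.
  have [z /C_span[w zw] zA] := cotree_flow connA (gA j).
  by exists w => e /zA <-; rewrite zw.
have [w wA] := fin_all_exists w_ex.
pose W := \matrix_(j, i) w j i.
have WC : W *m minor g = 1%:M.
  apply/matrixP=> j j'; rewrite !mxE.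
  under eq_bigr do rewrite !mxE.
  by rewrite wA // (inj_eq inj_g) eq_sym.
exists W => //; apply/matrixP=> i i'; rewrite !mxE; apply/esym/eqP.
rewrite -subr_eq0; apply/eqP.
pose u i' := (i == i')%:R - \sum_j minor g i j * W j i'.
apply: (C_free (w := u)); apply: (forest_flow0 forestA).
  by move=> x; rewrite boundary_sum big1 // => i1 _; rewrite C_flow mulr0.
move=> e eA; have /imsetP[j _ ->] : e \in [set g i | i : 'I_l].
  by rewrite im_g inE.
transitivity ((minor g - minor g *m W *m minor g) i j).
  rewrite -[in X in X - _](mul1mx (minor g)) -mulmxBl !mxE.
  by apply: eq_bigr => i1 _; rewrite !mxE.
by rewrite -mulmxA WC mulmx1 subrr mxE.
Qed.

(** A matrix over a nontrivial commutative ring with a two-sided inverse is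
    square. *)
Lemma card_cotree A : tree A -> #|~: A| = k.
Proof.
move=> treeA; have im : [set enum_val i | i : 'I_#|~: A|] = ~: A.
  apply/setP=> e; apply/imsetP/idP => [[i _ ->]|eA]; first exact: enum_valP.
  by exists (enum_rank_in eA e); rewrite ?enum_rankK_in.
have [W W1 W2] := tree_minor_inv (@enum_val_inj _ _) treeA im.
by apply/eqP; rewrite eqn_leq (mulmx1_min W1) (mulmx1_min W2).
Qed.

Hypothesis connG : forall h : G -> bool,
  (forall e, h (src e) = h (tgt e)) -> forall x y, h x = h y.

Lemma det_minor_sqr (g : {ffun 'I_k -> E}) :
  \det (minor g) ^+ 2 = (injectiveb g && tree (~: [set g i | i : 'I_k]))%:R.
Proof.
case: injectiveP => [inj_g|/injectiveP/injectivePn[i [j neq_ij eq_g]]] /=;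
  last first.
  rewrite -det_tr (determinant_alternate neq_ij) ?expr0n // => i1.
  by rewrite !mxE eq_g.
set A := ~: _.
have imA e : e \notin A -> exists j, e = g j.
  by rewrite inE negbK => /imsetP[j _ ->]; exists j.
have gA j : g j \notin A by rewrite inE negbK imset_f.
rewrite /tree; case: (boolP (conn A)) => [connA|]; last first.
  rewrite negb_forall => /existsP[x]; rewrite negb_forall => /existsP[y nxy] /=.
  (* The coboundary v of the component of x is orthogonal to all flows and
     vanishes on A; it is nonzero since G is connected. *)
  pose h x' := connect (link src tgt A) x x'.
  have [e he] : exists e, h (src e) != h (tgt e).
    apply/existsP; apply: contraR nxy; rewrite negb_exists => /forallP hE.
    rewrite -/(h y) -(connG _ x) /h ?connect0 // => e.
    by have := hE e; rewrite negbK => /eqP.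
  have hA e' : e' \in A -> h (src e') = h (tgt e').
    move=> e'A; apply: (same_connect_r (@connect_link_sym _ _ _ _ _)).
    exact/connect1/link_ends.
  pose v e : int := (h (tgt e))%:R - (h (src e))%:R.
  have ve : v e != 0 by rewrite /v; move: he; do 2!case: (h _).
  have [j def_e] : exists j, e = g j.
    by apply: imA; apply: contra he => /hA->.
  rewrite (@det_eq0_kernel _ (minor g) (v \o g) j) ?expr0n //= -?def_e // => i.
  have: \sum_x' (h x')%:R * boundary src tgt (C i) x' = 0.
    by rewrite big1 // => x' _; rewrite C_flow mulr0.
  rewrite sum_boundary (bigID (mem A)) /= big1 ?add0r; last first.
    by move=> e' /hA->; rewrite subrr mulr0.
  rewrite (eq_bigl (mem [set g i | i : 'I_k])); last first.
    by move=> e'; rewrite inE negbK.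
  rewrite big_imset /=; last by move=> ? ? _ _ /inj_g.
  by move=> E0; rewrite -[RHS]E0; apply: eq_bigr => j' _; rewrite mxE.
case: (boolP (forest A)) => [forestA|/cycle_supports_flow[z [e [dz ze zA]]]] /=.
  have im_g : [set g i | i : 'I_k] = ~: A by rewrite setCK.
  have [|W W1 _] := tree_minor_inv inj_g _ im_g; first by rewrite /tree connA.
  have := congr1 determinant W1; rewrite det_mulmx det1.
  by move/intUnitRing.unitzPl/orP=> [] /eqP->.
(* The flow z vanishes off A, that is, on the columns of the minor, so its
   coordinates are in the left kernel. *)
have [w zw] := C_span dz.
have [i wi] : exists i, w i != 0.
  apply/existsP; apply: contraR ze; rewrite negb_exists => /forallP w0.
  rewrite zw big1 // => i _; have := w0 i; rewrite negbK => /eqP->.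
  by rewrite mul0r.
rewrite -det_tr (@det_eq0_kernel _ (minor g)^T w i) ?expr0n // => j.
rewrite -[RHS](zA (g j)) // zw; apply: eq_bigr => i' _; rewrite !mxE; ring.
Qed.

Lemma card_trees_det :
  #|[set A | tree A]|%:R = \det (\matrix_(i, j) \sum_e C i e * C j e).
Proof.
have k_neq0 : k`!%:R != 0 :> int by rewrite pnatr_eq0 -lt0n fact_gt0.
apply: (mulfI k_neq0).
rewrite fact_det_gram (eq_bigr _ (fun g _ => det_minor_sqr g)).
rewrite -natr_sum -natrM; congr _%:R.
transitivity (\sum_(A | tree A) \sum_(g : {ffun 'I_k -> E} |
    injectiveb g && ([set g i | i : 'I_k] == ~: A)) 1)%N.
  rewrite (eq_bigr (fun=> k`!)); first by rewrite sum_nat_const cardsE mulnC.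
  by move=> A /card_cotree cardA; rewrite sum1dep_card card_inj_ffuns_onto.
rewrite (exchange_big_dep (fun g : {ffun 'I_k -> E} => injectiveb g)) /=;
  last first.
  by move=> A g _ /andP[].
rewrite [RHS](bigID (fun g : {ffun 'I_k -> E} => injectiveb g)) /=.
rewrite [X in (_ + X)%N]big1 ?addn0; last by move=> g /negPf->.
apply: eq_bigr => g inj_g; rewrite inj_g /=.
rewrite (eq_bigl (fun A => tree A && (A == ~: [set g i | i : 'I_k])));
  last first.
  by move=> A; rewrite -(inj_eq (@setC_inj _)) setCK eq_sym.
case: (boolP (tree _)) => treeA.
  rewrite (big_pred1 (~: [set g i | i : 'I_k])) // => A.
  by apply: andb_idl => /eqP->.
by rewrite big1 // => A /andP[/[swap]/eqP->]; rewrite (negPf treeA).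
Qed.

Hypothesis edgesE : edges G = [set ends src tgt e | e : E].

Lemma card_spanning_trees : #|spanning_trees G| = #|[set A | tree A]|.
Proof.
rewrite -(card_imset _ (imset_inj inj_ends)); apply: eq_card => F.
rewrite inE edgesE; apply/and3P/imsetP => [[sF cF aF]|[A]]; last first.
  rewrite inE => /andP[cA aA] ->; split=> //.
  by apply/subsetP=> f /imsetP[e _ ->]; apply: imset_f.
have defF : F = ends src tgt @: (ends src tgt @^-1: F).
  apply/setP=> f; apply/idP/imsetP => [fF|[e]]; last by rewrite inE => ? ->.
  by have /imsetP[e _ def_f] := subsetP sF f fF; exists e; rewrite ?inE -?def_f.
exists (ends src tgt @^-1: F) => //.
by rewrite inE /tree /conn /forest /link -defF cF.
Qed.

End BasisDeterminant.

(** * Heights of flows on the quadrant *)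

Definition on_class (p : bool) (i j : nat) : bool := odd (i + j) == p.

Lemma on_classSn p i j : on_class p i.+1 j = ~~ on_class p i j.
Proof. by rewrite /on_class addSn /=; case: odd p => [] []. Qed.

Lemma on_classnS p i j : on_class p i j.+1 = ~~ on_class p i j.
Proof. by rewrite /on_class addnS /=; case: odd p => [] []. Qed.

Section Height.

(** The flow sits on the unit cells of the quadrant: [Z i j] is its value on the
    cell whose corner with the largest coordinates is the point (i, j). *)
Variables (p : bool) (Z : nat -> nat -> int).

(** The sum of Z along the diagonal that leads down from (i, j), for the points
    off the class p, which stand for faces; the value 0 on the class p lets
    [height_diff] hold for all cells in one form. *)
Fixpoint height (i j : nat) : int :=
  match i, j with
  | i'.+1, j'.+1 => if on_class p i' j' then 0 else height i' j' + Z i j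
  | _, _ => 0
  end.

Lemma heightn0 i : height i 0 = 0.
Proof. by case: i. Qed.

Lemma height0n j : height 0 j = 0.
Proof. by []. Qed.

Lemma heightSS i j : ~~ on_class p i j ->
  height i.+1 j.+1 = height i j + Z i.+1 j.+1.
Proof. by move=> /= /negPf->. Qed.

Lemma height_on i j : on_class p i j -> height i j = 0.
Proof.
by case: i j => [|i] [|j] //=; rewrite on_classSn on_classnS negbK => ->.
Qed.

Hypothesis Z0n : forall j, Z 0 j = 0.
Hypothesis Zn0 : forall i, Z i 0 = 0.
(* Conservation at the point (i, j), whose four cells are listed: the two before
   it in the second coordinate and the two after it. *)
Hypothesis balance : forall i j, on_class p i j ->
  Z i j + Z i.+1 j = Z i j.+1 + Z i.+1 j.+1.

(** The face diagonal of this cell is not the one along which heights are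
    summed.  Moving to the cell one step down the diagonal changes the two heights by the
    flow on the two cells in between, and these four cells meet at (i, j), so
    that balance there closes the induction. *)
Lemma height_anti i j : on_class p i j ->
  Z i.+1 j.+1 = height i.+1 j - height i j.+1.
Proof.
elim: i j => [|i IHi] [|j] pij; have := balance pij.
- by rewrite !Z0n !Zn0 height0n heightn0; lra.
- rewrite !Z0n heightSS ?height0n; first by lra.
  by rewrite -on_classnS.
- rewrite !Zn0 heightn0 heightSS ?heightn0; first by lra.
  by rewrite -on_classSn.
move: pij; rewrite on_classSn on_classnS negbK => pij.
have := IHi _ pij; rewrite (heightSS (i := i.+1)) ?on_classSn ?pij //.
by rewrite (heightSS (j := j.+1)) ?on_classnS ?pij //; lra.
Qed.

Lemma height_diff i j : Z i.+1 j.+1 =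
  height i.+1 j + height i.+1 j.+1 - height i j - height i j.+1.
Proof.
have [pij|npij] := boolP (on_class p i j).
  rewrite height_anti // (height_on pij) (height_on (i := i.+1) (j := j.+1)).
    by ring.
  by rewrite on_classSn on_classnS negbK.
rewrite heightSS // (height_on (i := i.+1) (j := j)) ?on_classSn //.
by rewrite (height_on (i := i) (j := j.+1)) ?on_classnS //; ring.
Qed.

(** Beyond the support of Z, heights are constant along antidiagonals, which
    lead from (i, j) further away from the support to the axis j = 0. *)
Lemma height_right M : (forall i j, (M < i)%N -> Z i j = 0) ->
  forall i j, (M <= i)%N -> height i j = 0.
Proof.
move=> ZM i j; elim: j i => [|j IHj] i leMi; first exact: heightn0.
have [/height_on-> //|np] := boolP (on_class p i j.+1).
have := height_diff i j; rewrite ZM // !IHj ?(leqW leMi) //.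
rewrite (height_on (i := i.+1) (j := j.+1)) ?on_classSn //; lra.
Qed.

Lemma height_top N : (forall i j, (N < j)%N -> Z i j = 0) ->
  forall i j, (N <= j)%N -> height i j = 0.
Proof.
move=> ZN; elim=> [|i IHi] j leNj //.
have [/height_on-> //|np] := boolP (on_class p i.+1 j).
have := height_diff i j; rewrite ZN // !IHi ?(leqW leNj) //.
rewrite (height_on (i := i.+1) (j := j.+1)) ?on_classnS //; lra.
Qed.

End Height.

(** Steps along the cell diagonals lower j to 0, and then i by 2 at a time, down
    to the unique representative with i < 2. *)
Lemma parity_class_connected (p : bool) (M N : nat) (h : nat -> nat -> bool) :
  (0 < M)%N -> (0 < N)%N ->
  (forall a b, (a < M)%N -> (b < N)%N -> on_class p a b ->
     h a b = h a.+1 b.+1) ->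
  (forall a b, (a < M)%N -> (b < N)%N -> ~~ on_class p a b ->
     h a.+1 b = h a b.+1) ->
  forall i j, (i <= M)%N -> (j <= N)%N -> on_class p i j -> h i j = h p 0%N.
Proof.
move=> M0 N0 diag anti i j; elim: j i => [|j IHj] i leiM lejN.
  elim/ltn_ind: i leiM => -[|[|i]] IHi leiM.
  - by case: p {diag anti IHi}.
  - by case: p {diag anti IHi}.
  rewrite 2!on_classSn negbK => pi.
  rewrite anti ?on_classSn ?pi // -diag ?(ltnW leiM) //.
  by apply: IHi; rewrite // ltnW // ltnW.
rewrite on_classnS => pij; have [ltiM|leMi] := ltnP i M.
  by rewrite -anti // IHj ?on_classSn // ltnW.
case: i leMi leiM pij => [|i] leMi leiM; first by move: M0; rewrite ltnNge leMi.
by rewrite on_classSn negbK => pij; rewrite -diag // IHj // ltnW.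
Qed.

(** * Checkerboard graphs *)

Lemma sum_pick M x (F : nat -> int) :
  (x < M)%N -> \sum_(a < M) (x == a)%:R * F a = F x.
Proof.
move=> ltx; rewrite (bigD1 (Ordinal ltx)) //= eqxx mul1r big1 ?addr0 // => a.
by rewrite -val_eqE /= eq_sym => /negPf->; rewrite mul0r.
Qed.

(** The Gram matrix of the face boundaries in coordinates.  The left side is a
    product of a second difference in x and a second sum in y, equal to 2, -1
    or 0 and 2, 1 or 0 for distances 0, 1 or more.  Equal parity excludes
    the cases where exactly one distance is 1 and the other is 0. *)
Lemma grid_gram x y x' y' : odd (x + y) = odd (x' + y') ->
  ((x' == x)%:R - (x'.+1 == x)%:R - ((x' == x.+1)%:R - (x' == x)%:R)) *
  ((y'.+1 == y)%:R + (y' == y)%:R + ((y' == y)%:R + (y' == y.+1)%:R)) =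
  4 * ((x == x') && (y == y'))%:R
  - ((`|x - x'|%N == 1%N) && (`|y - y'|%N == 1%N))%:R :> int.
Proof.
move=> par.
have near (a b : nat) : a = b \/ a = b.+1 \/ b = a.+1 \/
    (a == b = false /\ b == a = false /\ b == a.+1 = false /\
     b.+1 == a = false /\ (`|a - b|%N == 1%N) = false) by lia.
have ne1 (a : nat) : (a.+1 == a = false) * (a == a.+1 = false).
  by split; lia.
have ne2 (a : nat) : (a.+2 == a = false) * (a == a.+2 = false).
  by split; lia.
case: (near x x') => [ex|[ex|[ex|[-> [-> [-> [-> ->]]]]]]];
  case: (near y y') => [ey|[ey|[ey|[-> [-> [-> [-> ->]]]]]]];
  rewrite ?ex ?ey ?eqxx ?eqSS ?ne1 ?ne2 ?distnn ?distnS ?distSn //=;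
  by move: par; rewrite ex ey ?addSn ?addnS /=; case: odd.
Qed.

Section GridDuality.

(** The graph of parity p on the (m + 2) x (n + 2) grid is V; the graph of the
    other parity on the m x n grid is its set of bounded faces.  Grid points are
    numbered from 0 for V; the 1-based coordinates of a face are then the
    0-based coordinates of its centre in the large grid.  The predicates P and Q
    are only fixed up to extensionality, so that either checkerboard graph is
    an instance of both V and the face graph. *)
Variables (m n : nat) (p : bool).
Variables (P : pred (diag_grid m.+2 n.+2)) (Q : pred (diag_grid m n)).
Hypothesis P_parity : forall q, P q = (odd (xcoord q + ycoord q) == p).
Hypothesis Q_parity : forall q, Q q = (odd (xcoord q + ycoord q) == ~~ p).

Let V := induced P.
Let face := induced Q.
Let cell := ('I_m.+1 * 'I_n.+1)%type.

Implicit Types (c : cell) (u : V) (v : face).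

Let col u : nat := (val u).1.
Let row u : nat := (val u).2.

Lemma P_on_class q : P q = on_class p q.1 q.2.
Proof. by rewrite P_parity /xcoord /ycoord addSn addnS /= negbK. Qed.

Lemma vertex_on_class u : on_class p (col u) (row u).
Proof. by rewrite -P_on_class (valP u). Qed.

Lemma vertex_eqE u u' : (u == u') = (col u == col u') && (row u == row u').
Proof.
by rewrite -val_eqE /col /row; case: (val u) (val u') => [a b] [a' b'].
Qed.

Lemma vertex_at i j : (i < m.+2)%N -> (j < n.+2)%N -> on_class p i j ->
  exists u, col u = i /\ row u = j.
Proof.
move=> lti ltj pij; pose q : diag_grid m.+2 n.+2 := (Ordinal lti, Ordinal ltj).
have Pq : P q by rewrite P_on_class.
by exists (exist _ q Pq).
Qed.

(* Edges are oriented towards the larger second coordinate, so that the ends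
   are told apart by their rows. *)
Let src_pt c : diag_grid m.+2 n.+2 :=
  (inord (c.1 + ~~ on_class p c.1 c.2), inord c.2).
Let tgt_pt c : diag_grid m.+2 n.+2 :=
  (inord (c.1 + on_class p c.1 c.2), inord c.2.+1).

Let lt_col c (b : bool) : (c.1 + b < m.+2)%N.
Proof. by have := ltn_ord c.1; case: b => /=; lia. Qed.

Let lt_row c : (c.2 < n.+2)%N.
Proof. exact: ltnW (ltn_ord c.2). Qed.

Fact src_subproof c : P (src_pt c).
Proof.
rewrite P_on_class /= !inordK ?lt_col ?lt_row //.
by case: (boolP (on_class p c.1 c.2)) => pc; rewrite ?addn0 // addn1 on_classSn.
Qed.

Fact tgt_subproof c : P (tgt_pt c).
Proof.
rewrite P_on_class /= !inordK ?lt_col //; last by rewrite ltnS.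
case: (boolP (on_class p c.1 c.2)) => pc; rewrite ?addn0 ?addn1 on_classnS //.
by rewrite on_classSn pc.
Qed.

Definition src c : V := exist _ (src_pt c) (src_subproof c).
Definition tgt c : V := exist _ (tgt_pt c) (tgt_subproof c).

Lemma col_src c : col (src c) = (c.1 + ~~ on_class p c.1 c.2)%N.
Proof. by rewrite /col /= inordK. Qed.

Lemma col_tgt c : col (tgt c) = (c.1 + on_class p c.1 c.2)%N.
Proof. by rewrite /col /= inordK. Qed.

Lemma row_src c : row (src c) = c.2.
Proof. by rewrite /row /= inordK. Qed.

Lemma row_tgt c : row (tgt c) = c.2.+1.
Proof. by rewrite /row /= inordK // ltnS. Qed.

Lemma src_eqE c u :
  (src c == u) =
  ((c.1 == col u :> nat) || (c.1.+1 == col u)) && (c.2 == row u :> nat).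
Proof.
rewrite vertex_eqE col_src row_src.
case: (c.2 =P row u :> nat) => [eqr|]; rewrite ?andbF // !andbT.
have := vertex_on_class u; rewrite -eqr.
have [pc|npc] := boolP (on_class p c.1 c.2) => pu; rewrite /= ?addn0 ?addn1.
  by case: (c.1.+1 =P _) pu => [<-|_]; rewrite ?orbF // on_classSn pc.
by case: (c.1 =P _ :> nat) pu => [<-|_] //; rewrite (negPf npc).
Qed.

Lemma tgt_eqE c u :
  (tgt c == u) =
  ((c.1 == col u :> nat) || (c.1.+1 == col u)) && (c.2.+1 == row u).
Proof.
rewrite vertex_eqE col_tgt row_tgt.
case: (c.2.+1 =P row u) => [eqr|]; rewrite ?andbF // !andbT.
have := vertex_on_class u; rewrite -eqr on_classnS.
have [pc|npc] := boolP (on_class p c.1 c.2) => pu; rewrite /= ?addn0 ?addn1.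
  by case: (c.1 =P _ :> nat) pu => [<-|_]; rewrite ?pc.
by case: (c.1.+1 =P _) pu => [<-|_]; rewrite ?orbF // on_classSn npc.
Qed.

Lemma src_neq_tgt c : src c != tgt c.
Proof. by rewrite vertex_eqE row_src row_tgt (ltn_eqF (ltnSn _)) andbF. Qed.

Lemma inj_ends_grid : injective (ends src tgt).
Proof.
move=> c c' /eq_set2[] [eq_src eq_tgt]; last first.
  have := congr1 row eq_src; have := congr1 row eq_tgt.
  by rewrite !row_src !row_tgt; lia.
have := congr1 row eq_src; rewrite !row_src => eq2.
have := congr1 col eq_src; have := congr1 col eq_tgt.
rewrite !col_src !col_tgt => eq_t eq_s.
have eq1 : c.1 = c'.1 :> nat by move: eq_s eq_t; do 2!case: on_class => /=; lia.
case: c c' eq1 eq2 {eq_src eq_tgt eq_t eq_s} => [a b] [a' b'].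
by move=> /= /val_inj-> /val_inj->.
Qed.

Lemma adjE u u' :
  adj u u' = (`|col u - col u'|%N == 1%N) && (`|row u - row u'|%N == 1%N).
Proof.
by rewrite -[adj u u']/(diag_adj (val u) (val u')) /diag_adj /= !(distnDl 1).
Qed.

Lemma adj_ends c : adj (src c) (tgt c).
Proof.
by rewrite adjE col_src col_tgt row_src row_tgt; case: on_class => /=; lia.
Qed.

Lemma edges_grid : edges V = [set ends src tgt c | c : cell].
Proof.
apply/setP=> e; rewrite inE; apply/existsP/imsetP=> [[u]|[c _ ->]]; last first.
  by exists (src c); apply/existsP; exists (tgt c); rewrite adj_ends eqxx.
case/existsP=> u' /andP[adj_u /eqP->].
wlog lt_row_u : u u' adj_u / (row u < row u')%N.
  move=> IH; have : row u != row u'.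
    by apply: contraTneq adj_u; rewrite adjE => ->; rewrite distnn andbF.
  by rewrite neq_ltn => /orP[/IH|/IH]; [|rewrite setUC adj_sym]; apply.
rewrite adjE in adj_u.
have lt1 : (minn (col u) (col u') < m.+1)%N.
  have := ltn_ord (val u).1; have := ltn_ord (val u').1.
  by rewrite -/(col u) -/(col u'); lia.
have lt2 : (row u < n.+1)%N.
  by have := ltn_ord (val u').2; rewrite -/(row u'); lia.
exists (Ordinal lt1, Ordinal lt2) => //; rewrite /ends.
have /eqP-> : src (Ordinal lt1, Ordinal lt2) == u by rewrite src_eqE /=; lia.
have /eqP-> // : tgt (Ordinal lt1, Ordinal lt2) == u'.
by rewrite tgt_eqE /=; lia.
Qed.

Lemma connected_grid (h : V -> bool) :
  (forall c, h (src c) = h (tgt c)) -> forall u u', h u = h u'.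
Proof.
move=> hE; pose H i j := [exists u, [&& col u == i, row u == j & h u]].
have H_at u : H (col u) (row u) = h u.
  apply/existsP/idP => [[u' /and3P[eqc eqr]]|hu].
    by have /eqP-> : u' == u by rewrite vertex_eqE eqc.
  by exists u; rewrite !eqxx.
have H_src c : H (c.1 + ~~ on_class p c.1 c.2)%N c.2 = h (src c).
  by rewrite -H_at col_src row_src.
have H_tgt c : H (c.1 + on_class p c.1 c.2)%N c.2.+1 = h (tgt c).
  by rewrite -H_at col_tgt row_tgt.
suff const u : h u = H p 0%N by move=> u u'; rewrite !const.
rewrite -H_at.
apply: (@parity_class_connected p m.+1 n.+1) (vertex_on_class u) => //.
- move=> a b lta ltb pab; have := hE (Ordinal lta, Ordinal ltb).
  by rewrite -H_src -H_tgt /= pab addn0 addn1.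
- move=> a b lta ltb /negPf pab; have := hE (Ordinal lta, Ordinal ltb).
  by rewrite -H_src -H_tgt /= pab addn0 addn1.
- exact: (ltn_ord (val u).1).
exact: (ltn_ord (val u).2).
Qed.

Let fx v : nat := xcoord (val v).
Let fy v : nat := ycoord (val v).

Lemma face_on_class v : ~~ on_class p (fx v) (fy v).
Proof. by have := valP v; rewrite Q_parity /on_class; case: odd p => [] []. Qed.

Lemma face_at i j : (i < m)%N -> (j < n)%N -> ~~ on_class p i.+1 j.+1 ->
  exists v, fx v = i.+1 /\ fy v = j.+1.
Proof.
move=> lti ltj pij; pose q : diag_grid m n := (Ordinal lti, Ordinal ltj).
have Qq : Q q.
  by rewrite Q_parity; move: pij; rewrite /on_class; case: odd p => [] [].
by exists (exist _ q Qq).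
Qed.

Lemma face_eqE v v' : (v == v') = (fx v == fx v') && (fy v == fy v').
Proof.
by rewrite -val_eqE /fx /fy; case: (val v) (val v') => [a b] [a' b'].
Qed.

Lemma lt_fx v : ((fx v).-1 < m.+1)%N /\ (fx v < m.+1)%N.
Proof. by split; [apply: ltnW|]; exact: (ltn_ord (val v).1). Qed.

Lemma lt_fy v : ((fy v).-1 < n.+1)%N /\ (fy v < n.+1)%N.
Proof. by split; [apply: ltnW|]; exact: (ltn_ord (val v).2). Qed.

(** The signs come from turning the edges by a quarter: the edge that crosses
    the step from the centre of v to a point with larger (smaller) first
    coordinate gets -1 (+1). *)
Definition face_cycle v c : int :=
  ((fx v == c.1.+1)%:R - (fx v == c.1)%:R) *
  ((fy v == c.2)%:R + (fy v == c.2.+1)%:R).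

Lemma sum_face_cycle v (F H : nat -> int) :
  \sum_c face_cycle v c * (F c.1 * H c.2) =
  (F (fx v).-1 - F (fx v)) * (H (fy v).-1 + H (fy v)).
Proof.
pose f a : int := (fx v == a.+1)%:R - (fx v == a)%:R.
pose g b : int := (fy v == b)%:R + (fy v == b.+1)%:R.
rewrite -(pair_bigA _
  (fun (a : 'I_m.+1) (b : 'I_n.+1) => f a * g b * (F a * H b))) /=.
transitivity ((\sum_(a < m.+1) f a * F a) * (\sum_(b < n.+1) g b * H b)).
  rewrite mulr_suml; apply: eq_bigr => a _; rewrite mulr_sumr.
  by apply: eq_bigr => b _; ring.
congr (_ * _).
  under eq_bigr do rewrite mulrBl.
  rewrite sumrB (sum_pick F (lt_fx v).2); congr (_ - _).
  exact: (sum_pick F (lt_fx v).1).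
under eq_bigr do rewrite mulrDl.
rewrite big_split addrC /= (sum_pick H (lt_fy v).2); congr (_ + _).
exact: (sum_pick H (lt_fy v).1).
Qed.

(** The product form makes all sums over cells below factor. *)
Lemma incidenceE c u : (tgt c == u)%:R - (src c == u)%:R =
  ((c.1 == col u :> nat)%:R + (c.1.+1 == col u)%:R) *
  ((c.2.+1 == row u)%:R - (c.2 == row u :> nat)%:R) :> int.
Proof.
rewrite src_eqE tgt_eqE -!mulnb !natrM -mulrBr; congr (_ * _).
case: (_ =P _) => [->|_]; rewrite /= ?add0r //.
by rewrite (gtn_eqF (ltnSn _)) addr0.
Qed.

Lemma face_cycle_flow v : flow src tgt (face_cycle v).
Proof.
move=> u; rewrite /boundary; under eq_bigr do rewrite incidenceE.
rewrite (sum_face_cycle v (fun a => (a == col u)%:R + (a.+1 == col u)%:R)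
  (fun b => (b.+1 == row u)%:R - (b == row u)%:R)) /=.
have := face_on_class v; rewrite /fx /fy /xcoord /ycoord /= => npv.
set a := nat_of_ord (val v).1 in npv *; set b := nat_of_ord (val v).2 in npv *.
transitivity (((a == col u)%:R - (a.+2 == col u)%:R) *
              ((b.+2 == row u)%:R - (b == row u)%:R) : int); first by ring.
have [/norP[/negPf-> /negPf->]|near_col] :=
  boolP (~~ ((a == col u) || (a.+2 == col u))); first by rewrite subrr mul0r.
have [/norP[/negPf-> /negPf->]|near_row] :=
  boolP (~~ ((b == row u) || (b.+2 == row u))); first by rewrite subrr mulr0.
have := vertex_on_class u; move: npv near_col near_row.
rewrite on_classSn on_classnS !negbK => /negPf npv /orP[]/eqP<- /orP[]/eqP<-;
  by rewrite ?on_classSn ?on_classnS ?negbK npv.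
Qed.

Lemma face_cycle_gram v v' : \sum_c face_cycle v c * face_cycle v' c =
  4 * (v == v')%:R - (adj v v')%:R.
Proof.
rewrite (sum_face_cycle v (fun a => (fx v' == a.+1)%:R - (fx v' == a)%:R)
  (fun b => (fy v' == b)%:R + (fy v' == b.+1)%:R)).
rewrite -[adj v v']/((`|fx v - fx v'|%N == 1%N) && (`|fy v - fy v'|%N == 1%N)).
rewrite face_eqE -grid_gram; last first.
  have := face_on_class v; have := face_on_class v'; rewrite /on_class.
  by case: odd (odd _) p => [] [] [].
by rewrite /fx /fy /xcoord /ycoord /= !eqSS.
Qed.

Let k := #|face|.
Let fc (i : 'I_k) c := face_cycle (enum_val i) c.

(** Face weights as a function on the quadrant, 0 away from the face centres. *)
Definition weight (w : 'I_k -> int) (i j : nat) : int :=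
  \sum_f w f * ((fx (enum_val f) == i) && (fy (enum_val f) == j))%:R.

Lemma sum_weight w c : \sum_f w f * fc f c =
  weight w c.1.+1 c.2 + weight w c.1.+1 c.2.+1
  - weight w c.1 c.2 - weight w c.1 c.2.+1.
Proof.
rewrite -big_split -!sumrB /=; apply: eq_bigr => f _.
by rewrite /fc /face_cycle -!mulnb !natrM; ring.
Qed.

Lemma weight_at w f : weight w (fx (enum_val f)) (fy (enum_val f)) = w f.
Proof.
rewrite /weight (bigD1 f) //= !eqxx mulr1 big1 ?addr0 // => f' nf.
by rewrite -face_eqE (inj_eq enum_val_inj) (negPf nf) mulr0.
Qed.

Lemma weight0 w i j : i = 0%N \/ j = 0%N \/ on_class p i j -> weight w i j = 0.
Proof.
move=> out; rewrite /weight big1 // => f _.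
case: (fx _ =P i) => [eqi|]; last by rewrite mulr0.
case: (fy _ =P j) => [eqj|]; last by rewrite mulr0.
case: out => [i0|[j0|]]; first by rewrite -eqi in i0.
  by rewrite -eqj in j0.
by rewrite -eqi -eqj (negPf (face_on_class _)).
Qed.

(** A combination that vanishes on all cells has equal weights at the two face
    points of each cell, and diagonals through these points lead to the axes,
    where the weight is 0. *)
Lemma face_cycle_free (w : 'I_k -> int) :
  (forall c, \sum_f w f * fc f c = 0) -> forall f, w f = 0.
Proof.
move=> w0 f; rewrite -weight_at; set v := enum_val f.
suff W0 i j : (i <= m)%N -> (j <= n)%N -> weight w i j = 0.
  by apply: W0; [apply: (ltn_ord (val v).1) | apply: (ltn_ord (val v).2)].
elim: i j => [|i IHi] [|j] lti ltj; try by apply: weight0; auto.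
have [pij|np] := boolP (on_class p i.+1 j.+1); first by apply: weight0; auto.
have lti' : (i < m.+1)%N by apply: ltnW.
have ltj' : (j < n.+1)%N by apply: ltnW.
have := w0 (Ordinal lti', Ordinal ltj'); rewrite sum_weight /=.
rewrite (@weight0 w i.+1 j); last by move: np; rewrite on_classnS negbK; auto.
rewrite (@weight0 w i j.+1); last by move: np; rewrite on_classSn negbK; auto.
by rewrite IHi ?(ltnW lti) ?(ltnW ltj) //; lra.
Qed.

(** The flow z is extended by 0 to the cells of the quadrant, with conservation
    at all points of the class; its heights are the coordinates. *)
Lemma face_cycle_span z : flow src tgt z ->
  exists w : 'I_k -> int, forall c, z c = \sum_f w f * fc f c.
Proof.
move=> dz; pose Z i j := \sum_c z c * ((c.1.+1 == i) && (c.2.+1 == j))%:R.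
have Z_at c : Z c.1.+1 c.2.+1 = z c.
  rewrite /Z (bigD1 c) //= !eqxx mulr1 big1 ?addr0 // => c' nc.
  rewrite !eqSS; move: nc.
  rewrite -pair_eqE /pair_eq /= -!val_eqE => /negPf /= ->.
  by rewrite mulr0.
have Z_out i j :
    i = 0%N \/ j = 0%N \/ (m.+1 < i)%N \/ (n.+1 < j)%N -> Z i j = 0.
  move=> out; rewrite /Z big1 // => c _.
  have := ltn_ord c.1; have := ltn_ord c.2.
  case: eqP => [e1|]; case: eqP => [e2|]; rewrite ?mulr0 //; lia.
have balance i j : on_class p i j ->
    Z i j + Z i.+1 j = Z i j.+1 + Z i.+1 j.+1.
  move=> pij; case: (ltnP m.+1 i) => [lti|lei].
    by rewrite !Z_out //; lia.
  case: (ltnP n.+1 j) => [ltj|lej]; first by rewrite !Z_out //; lia.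
  have [u [<- <-]] := vertex_at lei lej pij.
  have := dz u; rewrite /boundary; under eq_bigr do rewrite incidenceE.
  move=> dz0; apply/eqP; rewrite -subr_eq0 opprD addrA; apply/eqP.
  rewrite -[RHS]dz0 -big_split -!sumrB /=; apply: eq_bigr => c _.
  by rewrite -!mulnb !natrM !eqSS; ring.
pose H := height p Z.
have HE i j : Z i.+1 j.+1 = H i.+1 j + H i.+1 j.+1 - H i j - H i j.+1.
  by apply: height_diff => // *; apply: Z_out; auto.
exists (fun f => H (fx (enum_val f)) (fy (enum_val f))) => c.
rewrite sum_weight -Z_at HE; set w := fun _ => _.
suff WE i j : weight w i j = H i j by rewrite !WE.
have [f /andP[/eqP<- /eqP<-]|out] :=
  pickP (fun f : 'I_k => (fx (enum_val f) == i) && (fy (enum_val f) == j)).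
  by rewrite weight_at.
rewrite /weight big1 => [|f _]; last by rewrite out mulr0.
have [pij|np] := boolP (on_class p i j); first by rewrite /H height_on.
case: i => [|i] // in out np *.
case: j => [|j] in out np *; first by rewrite /H heightn0.
have [lti|leMi] := ltnP i m; last first.
  rewrite [RHS](@height_right p Z _ _ _ m.+1) // => *; apply: Z_out; lia.
have [ltj|leNj] := ltnP j n; last first.
  rewrite [RHS](@height_top p Z _ _ _ n.+1) // => *; apply: Z_out; lia.
have [v [eqx eqy]] := face_at lti ltj np.
by have := out (enum_rank v); rewrite enum_rankK eqx eqy !eqxx.
Qed.

Lemma grid_duality :
  #|spanning_trees V|%:Z = (graph_char_poly face).[4].
Proof.
rewrite (card_spanning_trees inj_ends_grid edges_grid) -[LHS]/(Posz _) -natz.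
rewrite (card_trees_det inj_ends_grid src_neq_tgt
  (fun f => face_cycle_flow (enum_val f))
  face_cycle_span face_cycle_free connected_grid).
rewrite /graph_char_poly /char_poly -horner_evalE -det_map_mx; congr (\det _).
apply/matrixP=> i j; rewrite !mxE /= horner_evalE !hornerE hornerMn hornerX.
rewrite face_cycle_gram (inj_eq enum_val_inj) mulr_natr; ring.
Qed.

End GridDuality.

Theorem theorem2 (m n : nat) (hm : (2 <= m)%N) (hn : (2 <= n)%N) :
  (#|spanning_trees (EC m n)|%:Z = (graph_char_poly (OC (m - 2) (n - 2))).[4])%R
  /\
  (#|spanning_trees (OC m n)|%:Z = (graph_char_poly (EC (m - 2) (n - 2))).[4])%R.
Proof.
case: m hm => [|[|m]] // _; case: n hn => [|[|n]] // _; rewrite !subSS !subn0.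
by split; [apply: (@grid_duality m n false) | apply: (@grid_duality m n true)];
   move=> q /=; case: odd.
Qed.
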